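(* The centered function $\tilde\nu(t)$ has the power series expansion $$\tilde\nu(t)=\frac{1}{2\sqrt2}\sum_{n=0}^\infty\frac{(-1)^n(3/2)_n}{n!}\,c_n\,t^n\qquad(|t|<1).$$
   Context: For $x>0$ let $\omega(x)=\sum_{m=1}^\infty(2\pi^2m^4x^2-3\pi m^2x)e^{-\pi m^2x}$. For $n\ge0$ define $$c_n=2\sqrt2\int_0^\infty\frac{\omega(x)}{(x+1)^{3/2}}\left(\frac{x-1}{x+1}\right)^n\,dx .$$ Define $$\nu(x)=\int_0^\infty\frac{\omega(u)}{(u+x)^{3/2}}\,du\qquad(x>0),\qquad\tilde\nu(t)=\frac{1}{(1+t)^{3/2}}\,\nu\left(\frac{1-t}{1+t}\right)\qquad(|t|<1).$$ $(a)_n=a(a+1)\cdots(a+n-1)$ is the Pochhammer symbol. *)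

(* Defs.v *)
From HB Require Import structures.
From mathcomp Require Import all_boot all_order all_algebra.
From mathcomp Require Import all_classical all_reals all_analysis.
Import Order.TTheory GRing.Theory Num.Theory.
Import numFieldNormedType.Exports.

Set Implicit Arguments.
Unset Strict Implicit.
Unset Printing Implicit Defensive.

Local Open Scope classical_set_scope.
Local Open Scope ring_scope.

Definition omega (R : realType) (x : R) : R :=
  limn (fun N : nat => \sum_(1 <= m < N)
    (2 * pi ^+ 2 * m%:R ^+ 4 * x ^+ 2 - 3 * pi * m%:R ^+ 2 * x)
    * expR (- (pi * m%:R ^+ 2 * x))).

(* `\int |m-th term of omega|` over ]0, +oo[ is O(1/m^2), so the Lebesgue integrals
   below converge absolutely (for x > 0 in the case of nu) and are not default
   values of Rintegral. *)
Definition coef_c (R : realType) (n : nat) : R :=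
  2 * Num.sqrt 2 *
  \int[@lebesgue_measure R]_(x in `]0, +oo[)
    (omega x / (x + 1) `^ (3 / 2) * ((x - 1) / (x + 1)) ^+ n).

Definition nu (R : realType) (x : R) : R :=
  \int[@lebesgue_measure R]_(u in `]0, +oo[) (omega u / (u + x) `^ (3 / 2)).

Definition centered_nu (R : realType) (t : R) : R :=
  ((1 + t) `^ (3 / 2))^-1 * nu ((1 - t) / (1 + t)).

Definition pochhammer (R : realType) (a : R) (n : nat) : R :=
  \prod_(0 <= i < n) (a + i%:R).

(* Main.v *)
Require Import Defs.
From HB Require Import structures.
From mathcomp Require Import all_boot all_order all_algebra.
From mathcomp Require Import all_classical all_reals all_analysis.
From mathcomp Require Import measurable_realfun exponential_distribution.
From mathcomp Require Import ring lra.
Import Order.TTheory GRing.Theory Num.Theory.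
Import numFieldNormedType.Exports.

Local Open Scope classical_set_scope.
Local Open Scope ring_scope.

(** Write [y = (x - 1) / (x + 1)], which has [`|y| <= 1] for [x > 0]. The
    identity [(1 + t) * (x + (1 - t) / (1 + t)) = (x + 1) * (1 + t * y)] turns
    the kernel of the centered function into
    [(x + 1) `^ (- (3 / 2)) * (1 + t * y) `^ (- (3 / 2))]
    ([kernel_factorization]). Since [`|t * y| < 1], the second factor is a
    binomial series in [t * y] ([binom_series]), and integrating it term by
    term against [omega x / (x + 1) `^ (3 / 2)] yields the numbers [coef_c].

    Term by term integration ([Rintegral_power_series]) is dominated
    convergence: the partial sums of the series are bounded by the convergent
    sum of its coefficients at [`|t|] ([binom_series_norm_bounded]), and
    [omega] is integrable on the half line ([integrable_omega]). The latter
    holds because the [m]-th term of [omega] is bounded by a multiple of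
    [expR (- (pi * m ^ 2 / 2) * x)], whose integral is of order [1 / m ^ 2].

    The binomial series is evaluated by means of the contiguity relation
    [F a z = (1 + z) * F (a + 1) z] between the sums with exponents [a] and
    [a + 1], together with [(F a)' = - a * F (a + 1)]: they make the derivative
    of [F a z * (1 + z) `^ a] vanish. The same relation, applied to partial
    sums at [- r], gives convergence for every exponent by induction. *)

(** * The binomial series *)

Section binomial_series.
Context {R : realType}.
Implicit Types (a b r z : R) (n k N : nat).

Lemma pochhammer0 a : pochhammer a 0 = 1.
Proof. by rewrite /pochhammer big_nil. Qed.

Lemma pochhammerSr a n : pochhammer a n.+1 = pochhammer a n * (a + n%:R).
Proof. by rewrite /pochhammer big_nat_recr. Qed.

Lemma pochhammerSl a n : pochhammer a n.+1 = a * pochhammer (a + 1) n.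
Proof.
rewrite /pochhammer big_nat_recl//= addr0; congr (_ * _).
by apply: eq_bigr => i _; rewrite -nat1r addrA.
Qed.

Lemma pochhammer_ge0 a n : 0 <= a -> 0 <= pochhammer a n.
Proof. by move=> a0; apply: prodr_ge0 => i _; rewrite addr_ge0. Qed.

Lemma ler_pochhammer a b n : 0 <= a -> a <= b ->
  pochhammer a n <= pochhammer b n.
Proof.
move=> a0 ab; apply: ler_prod => i _.
by rewrite addr_ge0//= lerD2r.
Qed.

Lemma ler_norm_pochhammer a n : `|pochhammer a n| <= pochhammer `|a| n.
Proof.
rewrite /pochhammer normr_prod; apply: ler_prod => i _.
by rewrite normr_ge0/= (le_trans (ler_normD _ _))// normr_nat.
Qed.

(** The coefficient of [z ^+ n] in [(1 + z) `^ (- a)]. *)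
Definition binom_coef a n : R := (-1) ^+ n * pochhammer a n / n`!%:R.

Lemma natfact_neq0 n : (n`!%:R : R) != 0.
Proof. by rewrite pnatr_eq0 -lt0n fact_gt0. Qed.

Lemma binom_coef0 a : binom_coef a 0 = 1.
Proof. by rewrite /binom_coef pochhammer0 expr0 fact0 mulr1 divr1. Qed.

(** This is the coefficientwise form of
    [(1 + z) `^ (- a) = (1 + z) * (1 + z) `^ (- (a + 1))]; both the convergence
    and the evaluation of the binomial series rest on it. *)
Lemma binom_coef_contiguous a n :
  binom_coef a n.+1 = binom_coef (a + 1) n.+1 + binom_coef (a + 1) n.
Proof.
rewrite /binom_coef (pochhammerSl a) pochhammerSr factS natrM exprS.
have n1 : (n.+1%:R : R) != 0 by rewrite pnatr_eq0.
have := natfact_neq0 n.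
by rewrite -natr1 in n1 * => n0; field; rewrite n0 n1.
Qed.

(** Formal differentiation stays within the family of binomial series, so that
    convergence for all exponents at once settles the convergence of the
    derived series too. *)
Lemma pseries_diffs_binom_coef a :
  pseries_diffs (binom_coef a) = (fun n => - a * binom_coef (a + 1) n).
Proof.
apply/funext => n; rewrite /pseries_diffs /binom_coef pochhammerSl factS natrM.
have n1 : (n.+1%:R : R) != 0 by rewrite pnatr_eq0.
have n0 := natfact_neq0 n.
by rewrite exprS; field; rewrite n0 nat1r n1.
Qed.

Lemma binom_series_contiguous a z N :
  pseries (binom_coef a) z N.+1 =
  pseries (binom_coef (a + 1)) z N.+1 + z * pseries (binom_coef (a + 1)) z N.
Proof.
rewrite /pseries /series/= !big_nat_recl//= !binom_coef0 -addrA; congr (_ + _).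
rewrite mulr_sumr -big_split/=; apply: eq_bigr => i _.
by rewrite binom_coef_contiguous mulrDl exprS; congr (_ + _); ring.
Qed.

(** At [- r] with [r >= 0] the signs cancel: the binomial series for a
    nonnegative exponent is there a series with nonnegative terms. *)
Lemma binom_coefN a r n :
  binom_coef a n * (- r) ^+ n = pochhammer a n / n`!%:R * r ^+ n.
Proof.
have sgn2 : (-1) ^+ n * (-1) ^+ n = 1 :> R.
  by rewrite -exprMn mulrNN mulr1 expr1n.
transitivity ((-1) ^+ n * (-1) ^+ n * (pochhammer a n / n`!%:R * r ^+ n)).
  by rewrite /binom_coef (exprNn r); ring.
by rewrite sgn2 mul1r.
Qed.

(** Induction on the exponent. Let [T] and [T'] be the partial sums at [- r]
    for the exponents [k] and [k.+1]. Contiguity reads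
    [T N.+1 = T' N.+1 - r * T' N], and [T' N <= T' N.+1] turns it into
    [(1 - r) * T' N <= T N.+1]. The induction starts from the exponent 0,
    whose series is the constant 1. *)
Lemma binom_series_bounded_nat k r : 0 <= r < 1 ->
  exists M, forall N, pseries (binom_coef k%:R) (- r) N <= M.
Proof.
move=> /andP[r0 r1]; elim: k => [|k [M IH]].
  exists 1 => -[|N]; rewrite /pseries /series/=; first by rewrite big_nil.
  rewrite big_nat_recl//= binom_coef0 expr0 mulr1 big1 ?addr0// => i _.
  by rewrite /binom_coef pochhammerSl !(mul0r, mulr0).
exists (M / (1 - r)) => N.
rewrite ler_pdivlMr ?subr_gt0//; apply: le_trans (IH N.+1).
rewrite binom_series_contiguous natr1.
suff : pseries (binom_coef k.+1%:R) (- r) N <=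
       pseries (binom_coef k.+1%:R) (- r) N.+1 by lra.
rewrite /pseries /series/= big_nat_recr//= lerDl binom_coefN.
by rewrite mulr_ge0 ?exprn_ge0// divr_ge0 ?pochhammer_ge0.
Qed.

(** A real exponent [a] is dominated by any natural number above [`|a|], since
    the Pochhammer symbol is monotone in its nonnegative argument. *)
Lemma binom_series_norm_bounded a r : 0 <= r < 1 ->
  exists M, forall N, \sum_(0 <= n < N) `|binom_coef a n| * r ^+ n <= M.
Proof.
move=> r01; have /andP[r0 _] := r01.
have [M leM] := binom_series_bounded_nat (Num.truncn `|a|).+1 r r01.
exists M => N; apply: le_trans (leM N); apply: ler_sum => n _ /=.
rewrite binom_coefN ler_wpM2r ?exprn_ge0//.
rewrite /binom_coef !normrM normrX normrN1 expr1n mul1r normfV normr_nat.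
rewrite ler_wpM2r ?invr_ge0// (le_trans (ler_norm_pochhammer _ _))//.
by apply: ler_pochhammer => //; exact/ltW/Num.Theory.truncnS_gt.
Qed.

Lemma is_cvg_binom_series a z : `|z| < 1 -> cvgn (pseries (binom_coef a) z).
Proof.
move=> z1; have [|M leM] := binom_series_norm_bounded a `|z|.
  by rewrite normr_ge0.
apply: normed_cvg; apply: nondecreasing_is_cvgn.
  by apply: nondecreasing_series => n _ _; rewrite normr_ge0.
exists M => _ [N _ <-]; apply: le_trans (leM N).
by apply: ler_sum => n _ /=; rewrite normrM normrX.
Qed.

Definition binom_sum a z : R := limn (pseries (binom_coef a) z).

Lemma binom_sum0 a : binom_sum a 0 = 1.
Proof.
rewrite /binom_sum; apply/cvg_lim => //; rewrite -cvg_shiftS/=.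
rewrite (_ : (fun _ => _) = cst 1); first exact: cvg_cst.
apply/funext => n; rewrite /pseries /series/= big_nat_recl//= binom_coef0.
by rewrite expr0 mulr1 big1 ?addr0// => i _; rewrite expr0n mulr0.
Qed.

Lemma binom_sum_contiguous a z : `|z| < 1 ->
  binom_sum a z = (1 + z) * binom_sum (a + 1) z.
Proof.
move=> z1.
have cv1 := is_cvg_binom_series (a + 1) _ z1.
apply/cvg_lim => //; rewrite -cvg_shiftS/=.
under eq_cvg do rewrite binom_series_contiguous.
rewrite mulrDl mul1r; apply: cvgD; first by rewrite cvg_shiftS.
by apply: cvgM => //; exact: cvg_cst.
Qed.

Lemma is_derive_binom_sum a z : `|z| < 1 ->
  is_derive z 1 (binom_sum a) (- a * binom_sum (a + 1) z).
Proof.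
move=> z1.
(* Term by term differentiation asks for convergence at a point strictly
   between [z] and the boundary of the disc. *)
pose K := (`|z| + 1) / 2.
have K0 : 0 <= K by rewrite /K; have := normr_ge0 z; lra.
have zK : `|z| < `|K| by rewrite (ger0_norm K0) /K; lra.
have K1 : `|K| < 1 by rewrite (ger0_norm K0) /K; lra.
have diffs b w : pseries (pseries_diffs (binom_coef b)) w =
    (- b) *: pseries (binom_coef (b + 1)) w.
  apply/funext => N; rewrite pseries_diffs_binom_coef.
  rewrite -[RHS]/(- b * pseries _ w N) /pseries /series/= mulr_sumr.
  by apply: eq_bigr => i _; rewrite -mulrA.
have diffsZ (c : R^nat) b w : pseries (pseries_diffs (fun n => b * c n)) w =
    b *: pseries (pseries_diffs c) w.
  apply/funext => N; rewrite -[RHS]/(b * pseries _ w N).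
  rewrite /pseries /pseries_diffs /series/= mulr_sumr.
  by apply: eq_bigr => i _; rewrite -!mulrA mulrCA.
have -> : - a * binom_sum (a + 1) z =
    limn (pseries (pseries_diffs (binom_coef a)) z).
  by rewrite diffs limZl_tmp//; exact: is_cvg_binom_series.
rewrite /binom_sum; apply: (@pseries_snd_diffs _ _ K) => //.
- exact: is_cvg_binom_series.
- by rewrite diffs; apply: is_cvgZl_tmp; exact: is_cvg_binom_series.
- rewrite pseries_diffs_binom_coef diffsZ diffs.
  by do 2 apply: is_cvgZl_tmp; exact: is_cvg_binom_series.
Qed.

(** The quotient of both sides is constant: the derivative of
    [binom_sum a w * (1 + w) `^ a] is
    [a * (1 + w) `^ (a - 1) * (binom_sum a w - (1 + w) * binom_sum (a + 1) w)],
    which vanishes by contiguity, and the value at 0 is 1. *)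
Lemma binom_sumE a z : `|z| < 1 -> binom_sum a z = (1 + z) `^ (- a).
Proof.
move=> z1.
pose G w : R := binom_sum a w * (1 + w) `^ a.
have pos (w : R) : `|w| < 1 -> 0 < 1 + w.
  by rewrite ltr_norml => /andP[? _]; lra.
have dG (w : R) : `|w| < 1 -> is_derive w 1 G 0.
  move=> w1; have w0 := pos _ w1.
  have d1 := is_derive_binom_sum a _ w1.
  have d2 : is_derive w 1 (fun w => (1 + w) `^ a) (a * (1 + w) `^ (a - 1)).
    have dadd : is_derive w 1 (fun w : R => 1 + w) 1.
      have := is_deriveD (is_derive_cst (1 : R) w 1) (is_derive_id w 1).
      by rewrite add0r.
    have := is_derive1_comp (is_derive1_powR a w0) dadd.
    by rewrite mulr1.
  apply: (is_derive_eq (is_deriveM d1 d2)).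
  have e : (1 + w) `^ a = (1 + w) `^ (a - 1) * (1 + w).
    rewrite -{1}(subrK 1 a) (@powRD _ _ (a - 1) 1) ?powRr1 ?ltW//.
    by apply/implyP => _; rewrite gt_eqF.
  by rewrite binom_sum_contiguous// e /GRing.scale/=; ring.
have GE (w v : R) : `|w| < 1 -> `|v| < 1 -> G w = G v.
  wlog wv : w v / w <= v => [h w1 v1|w1 v1].
    by case: (leP w v) => [/h|/ltW /h h']; [exact|rewrite h'].
  have sub x : x \in `[w, v] -> `|x| < 1.
    rewrite in_itv/= => /andP[? ?]; move: w1 v1.
    by rewrite !ltr_norml => /andP[? ?] /andP[? ?]; apply/andP; split; lra.
  have [||c _] := @MVT_segment _ G (fun=> 0) w v wv.
  - by move=> x /subset_itv_oo_cc /sub; exact: dG.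
  - apply: derivable_within_continuous => x /sub /dG d; exact: ex_derive.
  - by rewrite mul0r => /eqP; rewrite subr_eq0 eq_sym => /eqP.
have := GE z 0 z1; rewrite normr0 ltr01 => /(_ isT).
rewrite /G binom_sum0 addr0 powR1 mulr1 => h.
rewrite powRN -[RHS]mul1r; apply: (canRL (mulfK _) h).
by rewrite gt_eqF// powR_gt0// pos.
Qed.

Lemma binom_series a z : `|z| < 1 ->
  pseries (binom_coef a) z @ \oo --> (1 + z) `^ (- a).
Proof. by move=> z1; rewrite -binom_sumE//; exact: is_cvg_binom_series. Qed.

End binomial_series.

(** * Integration of power series of a bounded function *)

Section integral_power_series.
Context (d : measure_display) (T : measurableType d) (R : realType).
Variables (mu : {measure set T -> \bar R}) (D : set T).
Variables (f phi g : T -> R) (u : R^nat) (M : R).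
Hypotheses (mD : measurable D) (mphi : measurable_fun D phi).
Hypothesis intf : mu.-integrable D (EFin \o f).
Hypothesis phi1 : forall x, D x -> `|phi x| <= 1.
Hypothesis u_bounded : forall N, \sum_(0 <= n < N) `|u n| <= M.
Hypothesis series_g : forall x, D x -> pseries u (phi x) @ \oo --> g x.

Let mf : measurable_fun D f.
Proof. by move/integrableP : intf => [/measurable_EFinP]. Qed.

Let partial N x := \sum_(0 <= n < N) u n * (f x * phi x ^+ n).

Let partialE N x : partial N x = f x * pseries u (phi x) N.
Proof.
rewrite /partial /pseries /series/= mulr_sumr.
by apply: eq_bigr => n _; rewrite mulrCA.
Qed.

Let mpartial N : measurable_fun D (partial N).
Proof.
apply: measurable_sum => n; apply: measurable_funM => //.
by apply: measurable_funM => //; exact: measurable_funX.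
Qed.

Let partial_le N x : D x -> `|partial N x| <= M * `|f x|.
Proof.
move=> Dx; rewrite partialE normrM mulrC ler_wpM2r//.
apply: le_trans (u_bounded N); rewrite /pseries /series/=.
apply: le_trans (ler_norm_sum _ _ _) _; apply: ler_sum => n _.
by rewrite normrM normrX ler_piMr// exprn_ile1// phi1.
Qed.

Let int_bound : mu.-integrable D (fun x => (M * `|f x|)%:E).
Proof.
have := integrableZl mD M (integrable_abse intf).
by apply: eq_integrable => // x _; rewrite /= EFinM.
Qed.

Let cvg_partial x : D x -> (partial N x)%:E @[N --> \oo] --> (f x * g x)%:E.
Proof.
move=> Dx; apply: cvg_EFin; first by near=> N.
under eq_cvg do rewrite /= partialE.
by apply: cvgM; [exact: cvg_cst|exact: series_g].
Unshelve. all: by end_near. Qed.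

(** The series is dominated by [M * `|f|] because [`|phi| <= 1] and the
    coefficients are absolutely summable. *)
Let dominated : mu.-integrable D (EFin \o (f \* g)) /\
  (\int[mu]_(x in D) (partial N x)%:E @[N --> \oo] -->
   \int[mu]_(x in D) (f x * g x)%:E)%E.
Proof.
have [] // := @dominated_convergence _ _ _ mu D mD
  (fun N => EFin \o partial N) (EFin \o (f \* g)) (fun x => (M * `|f x|)%:E).
- by move=> N; exact/measurable_EFinP.
- apply: (emeasurable_fun_cvg (fun N => EFin \o partial N)) => //.
  by move=> N; exact/measurable_EFinP.
- exact: aeW.
- by apply: aeW => x N Dx; rewrite /= lee_fin partial_le.
Qed.

Lemma integrable_power_series : mu.-integrable D (EFin \o (f \* g)).
Proof. exact: dominated.1. Qed.

Lemma Rintegral_power_series :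
  \sum_(0 <= n < N) u n * \int[mu]_(x in D) (f x * phi x ^+ n) @[N --> \oo]
  --> \int[mu]_(x in D) (f x * g x).
Proof.
have int_monomial n : mu.-integrable D (EFin \o (fun x => f x * phi x ^+ n)).
  apply: (le_integrable mD _ _ intf).
    apply/measurable_EFinP; apply: measurable_funM => //.
    exact: measurable_funX.
  move=> x Dx; rewrite /= lee_fin normrM normrX ler_piMr// exprn_ile1//.
  exact: phi1.
have int_partial N : (\int[mu]_(x in D) (partial N x)%:E =
    (\sum_(0 <= n < N) u n * \int[mu]_(x in D) (f x * phi x ^+ n))%:E)%E.
  under eq_integral do rewrite /partial -sumEFin.
  rewrite integral_sum//; last first.
    move=> n; have := integrableZl mD (u n) (int_monomial n).
    by apply: eq_integrable => // x _; rewrite /= EFinM.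
  rewrite -sumEFin; apply: eq_bigr => n _.
  under eq_integral do rewrite EFinM.
  rewrite integralZl//; last exact: int_monomial.
  rewrite EFinM fineK//; exact: (integrable_fin_num mD (int_monomial n)).
have := dominated.2.
under eq_cvg do rewrite int_partial.
rewrite -(@fineK _ (\int[mu]_(x in D) (f x * g x)%:E)%E); last first.
  exact: (integrable_fin_num mD integrable_power_series).
by move=> /fine_cvg.
Qed.

End integral_power_series.

(** * Integrability of omega *)

Section omega_integrable.
Context {R : realType}.
Implicit Types (x : R) (m N : nat).
Local Notation mu := (@lebesgue_measure R).

Definition omega_term m x : R :=
  (2 * pi ^+ 2 * m%:R ^+ 4 * x ^+ 2 - 3 * pi * m%:R ^+ 2 * x)
  * expR (- (pi * m%:R ^+ 2 * x)).

Definition omega_rate m : R := pi * m%:R ^+ 2 / 2.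

(** An exponential with half the decay rate of the [m]-th term of [omega]:
    simple enough to be integrated exactly, with an integral of order
    [1 / m ^ 2]. *)
Definition omega_majorant m x : R := 24 * expR (- (omega_rate m) * x).

Lemma omega_rate_gt0 m : 0 < omega_rate m.+1.
Proof. by rewrite /omega_rate divr_gt0// mulr_gt0 ?pi_gt0// exprn_gt0. Qed.

Lemma omega_rateV m : (omega_rate m)^-1 = 2 / pi * (m%:R ^+ 2)^-1.
Proof. by rewrite /omega_rate !invfM invrK; ring. Qed.

Lemma omega_majorant_ge0 m x : 0 <= omega_majorant m x.
Proof. by rewrite mulr_ge0// expR_ge0. Qed.

(** With [s := omega_rate m * x] the term is
    [(8 * s ^+ 2 - 6 * s) * expR (- s) * expR (- s)]; one of the two
    exponentials absorbs the polynomial, since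
    [`|8 * s ^+ 2 - 6 * s| <= 24 * (1 + s ^+ 2 / 2) <= 24 * expR s]. *)
Lemma omega_term_le m x : 0 <= x -> `|omega_term m x| <= omega_majorant m x.
Proof.
move=> x0; pose s := omega_rate m * x.
have s0 : 0 <= s.
  by rewrite mulr_ge0// /omega_rate divr_ge0// mulr_ge0 ?pi_ge0// exprn_ge0.
have -> : omega_term m x = (8 * s ^+ 2 - 6 * s) * expR (- s) * expR (- s).
  rewrite -mulrA -expRD /omega_term; congr (_ * expR _); rewrite /s /omega_rate.
    by field.
  by field.
rewrite /omega_majorant mulNr -/s normrM (ger0_norm (expR_ge0 _)).
rewrite ler_wpM2r ?expR_ge0// normrM (ger0_norm (expR_ge0 _)) expRN.
rewrite ler_pdivrMr ?expR_gt0//.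
have := expR_ge1Dxn 1 s0; rewrite (_ : 2`!%:R = 2)// => es.
apply: (@le_trans _ _ (24 * (1 + s ^+ 2 / 2))); last by rewrite ler_wpM2l.
rewrite ler_norml; apply/andP; split; nra.
Qed.

(** Comparison with the telescoping series of general term
    [2 / (m.+1 * m.+2)]. *)
Lemma sum_inv_sqr_le N : \sum_(0 <= m < N) (m.+1%:R ^+ 2)^-1 <= 2 :> R.
Proof.
suff : \sum_(0 <= m < N) (m.+1%:R ^+ 2)^-1 <= 2 - 2 / N.+1%:R :> R.
  by move=> /le_trans; apply; rewrite gerBl divr_ge0.
elim: N => [|N IH]; first by rewrite big_nil divr1 subrr.
rewrite big_nat_recr//= (le_trans (lerD IH (lexx _)))//.
rewrite -(natr1 N.+1); have : 1 <= N.+1%:R :> R by rewrite ler1n.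
move: N.+1%:R => k k1.
rewrite -subr_ge0.
have -> : 2 - 2 / (k + 1) - (2 - 2 / k + (k ^+ 2)^-1) =
   (k - 1) / (k ^+ 2 * (k + 1)).
  by field; apply/andP; split; lra.
by rewrite divr_ge0 ?mulr_ge0 ?exprn_ge0//; lra.
Qed.

(** By [expR (- y) <= y^-1] the majorants at a fixed [x > 0] are of order
    [1 / m ^ 2]. *)
Lemma cvg_omega x : 0 < x ->
  series (fun m => omega_term m.+1 x) @ \oo --> omega x.
Proof.
move=> x0.
have cv : cvgn (series (fun m => omega_term m.+1 x)).
  apply: normed_cvg; apply: nondecreasing_is_cvgn.
    by apply: nondecreasing_series => n _ _; rewrite normr_ge0.
  exists (48 / (pi * x) * 2) => _ [N _ <-].
  apply: (@le_trans _ _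
      (48 / (pi * x) * \sum_(0 <= m < N) (m.+1%:R ^+ 2)^-1)).
    rewrite mulr_sumr; apply: ler_sum => m _.
    rewrite (le_trans (omega_term_le _ _ (ltW x0)))//.
    have rx : 0 < omega_rate m.+1 * x by rewrite mulr_gt0 ?omega_rate_gt0.
    rewrite /omega_majorant mulNr expRN.
    have -> : 48 / (pi * x) * (m.+1%:R ^+ 2)^-1 = 24 * (omega_rate m.+1 * x)^-1.
      by rewrite !(invfM _ x) omega_rateV; ring.
    rewrite ler_wpM2l// lef_pV2 ?posrE ?expR_gt0//.
    by rewrite (le_trans _ (expR_ge1Dx _))// lerDr.
  by rewrite ler_wpM2l ?sum_inv_sqr_le// divr_ge0// mulr_ge0 ?pi_ge0 ?ltW.
suff -> : omega x = limn (series (fun m => omega_term m.+1 x)) by [].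
rewrite /omega; apply/cvg_lim => //; rewrite -cvg_shiftS/=.
by under eq_cvg do rewrite big_add1/=.
Qed.

Lemma measurable_omega : measurable_fun (`]0, +oo[ : set R) (@omega R).
Proof.
apply: (measurable_fun_cvg
  (h := fun N x => series (fun m => omega_term m.+1 x) N)).
  move=> N; apply: measurable_sum => m.
  apply: measurable_funM.
    by apply: measurable_funB; apply: measurable_funM => //.
  by apply: measurableT_comp => //; apply: measurableT_comp.
by move=> x /=; rewrite in_itv/= andbT; exact: cvg_omega.
Qed.

Local Open Scope ereal_scope.

Lemma abse_omega_le x : (0 < x)%R ->
  `|(omega x)%:E| <= \sum_(m <oo) (omega_majorant m.+1 x)%:E.
Proof.
move=> x0.
have cv : `|series (fun m => omega_term m.+1 x) N|%:E @[N --> \oo]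
    --> `|(omega x)%:E|.
  by apply: cvg_EFin; [exact: nearW|apply: cvg_norm; exact: cvg_omega].
rewrite -(cvg_lim _ cv)//; apply: lime_le.
  by apply/cvg_ex; exists `|(omega x)%:E|.
apply: nearW => N.
apply: le_trans (nneseries_lim_ge N _); last first.
  by move=> m _ _; rewrite lee_fin omega_majorant_ge0.
rewrite sumEFin lee_fin (le_trans (ler_norm_sum _ _ _))//.
by apply: ler_sum => m _; exact: omega_term_le (ltW x0).
Qed.

(** The majorant is a multiple of the density of an exponential law, whose
    total mass is 1. *)
Lemma integral_omega_majorant m :
  \int[mu]_(x in `]0%R, +oo[) (omega_majorant m.+1 x)%:E <=
  (48 / pi * (m.+1%:R ^+ 2)^-1)%:E.
Proof.
have r0 := omega_rate_gt0 m.
have -> : \int[mu]_(x in `]0%R, +oo[) (omega_majorant m.+1 x)%:E =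
    \int[mu]_(x in `]0%R, +oo[)
      ((24 / omega_rate m.+1)%:E * (exponential_pdf (omega_rate m.+1) x)%:E).
  apply: eq_integral => x; rewrite inE/= in_itv/= andbT => x0.
  rewrite -EFinM exponential_pdfE ?ltW// /omega_majorant; congr EFin.
  by rewrite mulrA divfK ?gt_eqF.
have mpdf (D : set R) :
    measurable_fun D (EFin \o exponential_pdf (omega_rate m.+1)).
  by apply/measurable_EFinP/measurable_funTS; exact: measurable_exponential_pdf.
rewrite ge0_integralZl//; last 3 first.
- exact: mpdf.
- by move=> x _; rewrite lee_fin exponential_pdf_ge0// ltW.
- by rewrite lee_fin divr_ge0// ltW.
apply: (@le_trans _ _ ((24 / omega_rate m.+1)%:E * 1)).
  apply: lee_wpmul2l; first by rewrite lee_fin divr_ge0// ltW.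
  rewrite -(integral_exponential_pdf r0).
  apply: ge0_subset_integral => //.
    exact: mpdf.
  by move=> x _; rewrite lee_fin exponential_pdf_ge0// ltW.
rewrite mule1 lee_fin le_eqVlt; apply/orP; left; apply/eqP.
by rewrite omega_rateV; ring.
Qed.

(** The series of majorants may be integrated term by term, by monotone
    convergence, and the integrals of its terms are summable. *)
Lemma integrable_omega : mu.-integrable `]0%R, +oo[ (EFin \o @omega R).
Proof.
have mmaj m :
    measurable_fun (`]0%R, +oo[ : set R) (fun x => (omega_majorant m x)%:E).
  apply/measurable_EFinP; apply: measurable_funM => //.
  by apply: measurableT_comp => //; exact: measurable_funM.
apply: (@le_integrable _ _ _ mu _ _ _
  (fun x => \sum_(m <oo) (omega_majorant m.+1 x)%:E)) => //.
- by apply/measurable_EFinP; exact: measurable_omega.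
- move=> x /=; rewrite in_itv/= andbT => x0.
  by rewrite (le_trans (abse_omega_le x x0))// lee_abs.
apply/integrableP; split.
  apply: ge0_emeasurable_sum => [m x _ _|m _]; last exact: mmaj.
  by rewrite lee_fin omega_majorant_ge0.
under eq_integral.
  move=> x _; rewrite gee0_abs; last first.
    by apply: nneseries_ge0 => m _ _; rewrite lee_fin omega_majorant_ge0.
  over.
rewrite integral_nneseries//; last 2 first.
- by move=> m; exact: mmaj.
- by move=> m x _; rewrite lee_fin omega_majorant_ge0.
apply: (@le_lt_trans _ _ (48 / pi * 2)%:E); last exact: ltry.
apply: lime_le.
  apply: is_cvg_nneseries => m _ _; apply: integral_ge0 => x _.
  by rewrite lee_fin omega_majorant_ge0.
apply: nearW => N.
apply: (@le_trans _ _ (\sum_(0 <= m < N) (48 / pi * (m.+1%:R ^+ 2)^-1)%:E)).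
  by apply: lee_sum => m _; exact: integral_omega_majorant.
rewrite sumEFin lee_fin -mulr_sumr ler_wpM2l ?sum_inv_sqr_le//.
by rewrite divr_ge0// pi_ge0.
Qed.

End omega_integrable.

(** * The expansion of the centered function *)

Section omega_weight.
Context {R : realType}.
Implicit Types (t x : R).
Local Notation mu := (@lebesgue_measure R).

Definition cayley x : R := (x - 1) / (x + 1).

Definition omega_weight x : R := omega x / (x + 1) `^ (3 / 2).

Lemma cayley_norm_le1 x : 0 < x -> `|cayley x| <= 1.
Proof.
move=> x0; have x1 : 0 < x + 1 by lra.
rewrite /cayley normrM normfV (gtr0_norm x1).
by rewrite ler_pdivrMr ?mul1r ?ler_norml; [apply/andP; split|]; lra.
Qed.

Lemma measurable_cayley : measurable_fun (`]0, +oo[ : set R) cayley.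
Proof.
apply: (eq_measurable_fun (fun x => (x - 1) * (x + 1) `^ (-1))) => [x|].
  rewrite inE/= in_itv/= andbT => x0.
  by rewrite powR_inv1// ltW// ltr_wpDl// ltW.
apply: measurable_funM; first exact: measurable_funB.
apply: (measurableT_comp (measurable_powR _)) => //.
exact: measurable_funD.
Qed.

Lemma integrable_omega_weight :
  mu.-integrable `]0, +oo[ (EFin \o omega_weight).
Proof.
apply: (le_integrable _ _ _ integrable_omega) => //.
  apply/measurable_EFinP; apply: measurable_funM; first exact: measurable_omega.
  apply: (eq_measurable_fun (fun x => (x + 1) `^ (- (3 / 2)))) => [x _|].
    by rewrite powRN.
  apply: (measurableT_comp (measurable_powR _)) => //.
  exact: measurable_funD.
move=> x /=; rewrite in_itv/= andbT => x0.
rewrite lee_fin /omega_weight normrM ler_piMr//.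
rewrite normfV ger0_norm ?powR_ge0// invf_le1; last first.
  by rewrite powR_gt0// addr_gt0.
have : 1 `^ (3 / 2) <= (x + 1) `^ (3 / 2).
  by apply: ge0_ler_powR; rewrite ?nnegrE ?lerDr ?addr_ge0// ltW.
by rewrite powR1.
Qed.

(** Everything comes from
    [(1 + t) * (x + (1 - t) / (1 + t)) = (x + 1) * (1 + t * cayley x)], whose
    two sides equal [(x + 1) + t * (x - 1)]. *)
Lemma kernel_factorization t x : `|t| < 1 -> 0 < x ->
  ((x + (1 - t) / (1 + t)) `^ (3 / 2))^-1 =
  (1 + t) `^ (3 / 2) *
  (((x + 1) `^ (3 / 2))^-1 * (1 + t * cayley x) `^ (- (3 / 2))).
Proof.
rewrite ltr_norml => /andP[t1 t2] x0; have x1 : 0 < x + 1 by lra.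
have tp : 0 < 1 + t by lra.
have yp : 0 < x + (1 - t) / (1 + t) by rewrite addr_gt0// divr_gt0//; lra.
have e : (x + 1) * (1 + t * cayley x) = (1 + t) * (x + (1 - t) / (1 + t)).
  by rewrite /cayley; field; rewrite !gt_eqF.
have cp : 0 < 1 + t * cayley x.
  by rewrite -(pmulr_rgt0 _ x1) e mulr_gt0.
rewrite powRN -invfM -powRM ?(ltW x1) ?(ltW cp)// e powRM ?(ltW tp) ?(ltW yp)//.
by rewrite invfM mulrA divff ?mul1r// gt_eqF// powR_gt0.
Qed.

Lemma coef_cE n : coef_c R n = 2 * Num.sqrt 2 *
  \int[mu]_(x in `]0, +oo[) (omega_weight x * cayley x ^+ n).
Proof. by []. Qed.

End omega_weight.

Theorem theorem4p17 (R : realType) (t : R) (ht : `|t| < 1) :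
  (fun N : nat => (2 * Num.sqrt 2)^-1 *
     \sum_(0 <= n < N)
       ((-1) ^+ n * pochhammer (3 / 2) n / n`!%:R * coef_c R n * t ^+ n))
    @ \oo --> centered_nu t.
Proof.
have [|M leM] := binom_series_norm_bounded (3 / 2) `|t|.
  by rewrite normr_ge0.
pose g (x : R) := (1 + t * cayley x) `^ (- (3 / 2)).
pose u n := binom_coef (3 / 2) n * t ^+ n.
have mD : measurable (`]0, +oo[%classic : set R) by [].
have phi1 (x : R) : (`]0, +oo[%classic : set R) x -> `|cayley x| <= 1.
  by rewrite /= in_itv/= andbT; exact: cayley_norm_le1.
have u_le N : \sum_(0 <= n < N) `|u n| <= M.
  rewrite (le_trans _ (leM N))//; apply: ler_sum => n _.
  by rewrite normrM normrX.
have cvg_g (x : R) : (`]0, +oo[%classic : set R) x ->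
    pseries u (cayley x) @ \oo --> g x.
  move=> /phi1 cx; have tc : `|t * cayley x| < 1.
    by rewrite normrM (le_lt_trans _ ht)// ler_piMr.
  have -> : pseries u (cayley x) = pseries (binom_coef (3 / 2)) (t * cayley x).
    apply/funext => N; rewrite /pseries /series/=; apply: eq_bigr => n _.
    by rewrite /u (exprMn _ t) mulrA.
  exact: binom_series.
have int_g := @integrable_power_series _ _ R (@lebesgue_measure R) _
  omega_weight cayley g u M mD measurable_cayley integrable_omega_weight
  phi1 u_le cvg_g.
have := @Rintegral_power_series _ _ R (@lebesgue_measure R) _
  omega_weight cayley g u M mD measurable_cayley integrable_omega_weight
  phi1 u_le cvg_g.
have -> : centered_nu t =
    \int[lebesgue_measure]_(x in `]0, +oo[) (omega_weight x * g x).
  rewrite /centered_nu /nu.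
  have -> : \int[@lebesgue_measure R]_(x in `]0, +oo[)
      (omega x / (x + (1 - t) / (1 + t)) `^ (3 / 2)) =
    \int[lebesgue_measure]_(x in `]0, +oo[)
      ((1 + t) `^ (3 / 2) * (omega_weight x * g x)).
    apply: eq_Rintegral => x; rewrite inE/= in_itv/= andbT => x0.
    by rewrite kernel_factorization// /omega_weight /g mulrCA -!mulrA.
  rewrite RintegralZl// mulKf// gt_eqF// powR_gt0//.
  by move: ht; rewrite ltr_norml => /andP[]; lra.
apply: cvg_trans; apply: near_eq_cvg; apply: nearW => N /=.
rewrite mulr_sumr; apply: eq_bigr => n _.
rewrite coef_cE /u /binom_coef; field.
by rewrite natfact_neq0 gt_eqF// sqrtr_gt0.
Qed.
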